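(* Let $\omega\in\{0,1\}^\infty$. The graph $X_\omega$ has dense holonomy if and only if the sequence $\omega$ has both infinitely many $0$'s and infinitely many $1$'s.
   Context: $\{0,1\}^{\infty}$ is the set of infinite sequences $x_1x_2\ldots$ with $x_i\in\{0,1\}$. Definition of $X_\omega$. For $\omega=x_1x_2\ldots\in\{0,1\}^\infty$ and $n\ge 1$ put $a_n^{\omega}=\sum_{i=1}^n x_i2^{i-1}-2^{n-1}$. The graph $X_\omega$ is undirected with vertex set $V_\omega=\mathbb{Z}$. Its edges are those of the disjoint union $\coprod_{n\ge 0}E^n_\omega$, where $E^0_\omega=\{(z,z+1):z\in\mathbb{Z}\}$ and, for $n\ge1$, $E^n_\omega=\{(2^nz-a_n^\omega,\,2^n(z+1)-a_n^\omega):z\in\mathbb{Z}\}$; in addition, if there is a vertex not incident to any edge of $\coprod_{n\ge 1}E^n_\omega$ (there is at most one such vertex), a loop is added at that vertex. The graph $X_\omega$ is $4$-regular (a loop counts twice). Let $X$ be a graph of uniformly bounded valence. The ball $B(v,r)$ is the subgraph (loops included) induced by the vertices at graph distance at most $r$ from $v$, regarded as a graph pointed at $v$; $B(v,r)$ and $B(u,r)$ are isomorphic as pointed graphs if there is a graph isomorphism $B(v,r)\to B(u,r)$ mapping $v$ to $u$. $T_X(r)$ is the (finite) set of isomorphism classes of pointed $r$-balls of $X$, and the $r$-type $\alpha(v,r)\in T_X(r)$ of a vertex $v$ is the class of $B(v,r)$. The graph $X$ has dense holonomy if for any radius $r$ there exists $R=R(r)$ such that every $R$-ball in $X$ contains vertices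 of each $r$-type in $T_X(r)$. *)

(* Defs.v *)
From mathcomp Require Import all_boot all_order all_algebra.
From mathcomp Require Import boolp classical_sets functions cardinality.

Set Implicit Arguments.
Unset Strict Implicit.
Unset Printing Implicit Defensive.

Import Order.TTheory GRing.Theory Num.Theory.

Local Open Scope classical_set_scope.
Local Open Scope ring_scope.

(* Undirected multigraphs: loops and parallel edges are allowed. The order of
   the pair [ends e] carries no information, it is forgotten by [joins]. *)
Record graph := Graph {
  vert : Type;
  edge : Type;
  ends : edge -> vert * vert
}.

Definition joins (G : graph) (e : edge G) (u v : vert G) : Prop :=
  ends e = (u, v) \/ ends e = (v, u).

Inductive walk (G : graph) : nat -> vert G -> vert G -> Prop :=
| walk_nil (u : vert G) : walk 0 u u
| walk_cons (k : nat) (e : edge G) (u v w : vert G) :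
    joins e u v -> walk k v w -> walk k.+1 u w.

Definition dist_le (G : graph) (v : vert G) (r : nat) : set (vert G) :=
  [set u | exists2 k : nat, (k <= r)%N & walk k v u].

Definition induced (G : graph) (A : set (vert G)) : graph :=
  @Graph {u : vert G | A u}
         {e : edge G | A (ends e).1 /\ A (ends e).2}
         (fun e => (exist _ (ends (sval e)).1 (proj1 (svalP e)),
                    exist _ (ends (sval e)).2 (proj2 (svalP e)))).

Record pgraph := PGraph { pg_graph : graph; pg_point : vert pg_graph }.

Definition pg_iso (P Q : pgraph) : Prop :=
  exists (f : vert (pg_graph P) -> vert (pg_graph Q))
         (g : edge (pg_graph P) -> edge (pg_graph Q)),
    [/\ bijective f, bijective g,
        forall e, joins (g e) (f (ends e).1) (f (ends e).2)
      & f (pg_point P) = pg_point Q].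

Lemma dist_le_center (G : graph) (v : vert G) (r : nat) : dist_le v r v.
Proof. by exists 0%N => //; constructor. Qed.

Definition ball (G : graph) (v : vert G) (r : nat) : pgraph :=
  @PGraph (induced (dist_le v r)) (exist _ v (dist_le_center v r)).

Definition rtype (G : graph) (v : vert G) (r : nat) : set pgraph :=
  [set P | pg_iso (ball v r) P].

Definition rtypes (G : graph) (r : nat) : set (set pgraph) :=
  range (fun v : vert G => rtype v r).

Definition dense_holonomy (G : graph) : Prop :=
  forall r : nat, exists R : nat, forall v : vert G,
    forall t, rtypes G r t -> exists2 u, dist_le v R u & rtype u r = t.

(* A sequence x_1 x_2 x_3 ... is encoded as omega : nat -> bool with
   x_i = omega (i - 1); [acoef omega n] is meant for n >= 1 only. *)
Definition acoef (omega : nat -> bool) (n : nat) : int :=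
  (\sum_(i < n) (omega i)%:R * 2 ^+ i) - 2 ^+ n.-1.

(* The z-th edge of the n-th family; z |-> level_ends omega n z is injective,
   so the families are indexed by z without repeating an edge. *)
Definition level_ends (omega : nat -> bool) (n : nat) (z : int) : int * int :=
  if n is 0 then (z, z + 1)
  else (2 ^+ n * z - acoef omega n, 2 ^+ n * (z + 1) - acoef omega n).

Definition uncovered (omega : nat -> bool) : set int :=
  [set v | forall (n : nat) (z : int), (1 <= n)%N ->
     v <> (level_ends omega n z).1 /\ v <> (level_ends omega n z).2].

Definition Xedge (omega : nat -> bool) : Type :=
  ((nat * int) + {v : int | uncovered omega v})%type.

Definition Xgraph (omega : nat -> bool) : graph :=
  @Graph int (Xedge omega)
    (fun e => match e with
              | inl p => level_ends omega p.1 p.2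
              | inr l => (sval l, sval l)
              end).

(* Main.v *)
(* Since [acoef omega n] is the sum of the [x_i 2^(i-1)], i <= n, minus
   [2^(n-1)], a vertex [v] lies on the n-th family of edges iff [v + omega] has
   2-adic valuation [n - 1], where [omega] is read as a 2-adic integer. So every
   vertex has exactly one level [n >= 1], except the vertex [v = - omega] if
   [omega] is an ordinary integer, that is, if [omega] is eventually constant.
   That vertex would be the only one with a loop, and no ball around a far
   vertex sees it. If there is no such vertex, then X is the Schreier graph of
   the action of the free group on [u |-> u + 1] and
   [u |-> u + 2 ^+ level of u]; which words of length at most [r + 1] agree at
   [v] determines the [r]-ball of [v], and this pattern is unchanged when [v] is
   translated by a multiple of [2 ^+ N], for [N] above all levels met on the
   way. Finiteness of the set of patterns makes [N] uniform. *)
Require Import Defs.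
From mathcomp Require Import all_boot all_order all_algebra.
From mathcomp Require Import boolp classical_sets functions cardinality.
From mathcomp Require Import zify ring.

Set Implicit Arguments.
Unset Strict Implicit.
Unset Printing Implicit Defensive.

Import Order.TTheory GRing.Theory Num.Theory.

Local Open Scope classical_set_scope.

(** * Pointed isomorphism *)

Lemma pg_iso_refl (P : pgraph) : pg_iso P P.
Proof.
exists id, id; split=> //; try by exists id.
by move=> e; left; case: (ends e).
Qed.

Lemma pg_iso_trans (P Q S : pgraph) : pg_iso P Q -> pg_iso Q S -> pg_iso P S.
Proof.
move=> [f [g [fb gb fg fp]]] [f' [g' [fb' gb' fg' fp']]].
exists (f' \o f), (g' \o g); split; try exact: bij_comp.
  move=> e; rewrite /joins /=.
  by case: (fg e) (fg' (g e)) => -> [] /= ->; [left|right|right|left].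
by rewrite /= fp fp'.
Qed.

(** * Graphs generated by permutations of the vertices, and coincidences of words *)

Section SchreierGraph.
(** [mk] identifies the edges with pairs of an origin and a generator, so loops and parallel edges
    are counted correctly; [psi b] is the inverse of [phi b]. *)
Variables (G : graph) (B : finType) (phi psi : B -> vert G -> vert G).
Variables (mk : vert G -> B -> edge G) (lab : edge G -> B).
Hypotheses (phiK : forall b, cancel (phi b) (psi b))
  (psiK : forall b, cancel (psi b) (phi b))
  (ends_mk : forall u b, ends (mk u b) = (u, phi b u))
  (mkK : forall e, mk (ends e).1 (lab e) = e)
  (lab_mk : forall u b, lab (mk u b) = b).

Definition run (u : vert G) (w : seq (B * bool)) : vert G :=
  foldl (fun x g => if g.2 then phi g.1 x else psi g.1 x) u w.

Lemma run_rcons u w g :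
  run u (rcons w g) = if g.2 then phi g.1 (run u w) else psi g.1 (run u w).
Proof. by rewrite /run -cats1 foldl_cat. Qed.

Lemma endsE e : ends e = ((ends e).1, phi (lab e) (ends e).1).
Proof. by rewrite -{1}(mkK e) ends_mk. Qed.

Lemma walk_run k u v : walk k u v <-> exists2 w, size w = k & run u w = v.
Proof.
split.
  elim=> {k u v} [u|k e u v x uv _ [w <- <-]]; first by exists [::].
  case: uv; rewrite endsE => -[eu ev].
    by exists ((lab e, true) :: w) => //=; rewrite -ev -eu.
  by exists ((lab e, false) :: w) => //=; rewrite -ev -eu phiK.
move=> [w <- <-]; elim: w u => [|[b s] w IH] u /=; first exact: walk_nil.
case: s.
  by apply: (@walk_cons _ _ (mk u b)) (IH _); left; exact: ends_mk.
apply: (@walk_cons _ _ (mk (psi b u) b)) (IH _); right.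
by rewrite ends_mk psiK.
Qed.

Lemma dist_le_run v r u :
  dist_le v r u <-> exists2 w, (size w <= r)%N & run v w = u.
Proof.
split=> [[k kr /walk_run [w wk wu]]|[w wr wu]].
  by exists w => //; rewrite wk.
by exists (size w) => //; apply/walk_run; exists w.
Qed.

(** Words of bounded length form a finite type, hence so do the patterns; this allows a maximum over
    all of them. *)
Definition pattern (r : nat) (v : vert G) :
    {ffun r.-bseq (B * bool) * r.-bseq (B * bool) -> bool} :=
  [ffun p : r.-bseq (B * bool) * r.-bseq (B * bool) =>
    `[< run v p.1 = run v p.2 >]].

Lemma patternP r u v :
  pattern r u = pattern r v <->
  forall w1 w2, (size w1 <= r)%N -> (size w2 <= r)%N ->
    (run u w1 = run u w2 <-> run v w1 = run v w2).
Proof.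
split=> [uv w1 w2 s1 s2|uv].
  move/ffunP: uv => /(_ (Bseq s1, Bseq s2)); rewrite !ffunE /=.
  exact: asbool_eq_equiv.
apply/ffunP => -[w1 w2]; rewrite !ffunE /=; apply: asbool_equiv_eq.
exact: uv (size_bseq _) (size_bseq _).
Qed.

Definition transports (r : nat) (v v' : vert G) (F : vert G -> vert G) : Prop :=
  forall w, (size w <= r)%N -> F (run v w) = run v' w.

(** Words that meet when started at [v] also meet when started at [v'], so the endpoint at [v']
    depends only on the endpoint at [v]. *)
Lemma pattern_transports (r : nat) (v v' : vert G) :
  pattern r v = pattern r v' -> exists F, transports r v v' F.
Proof.
move=> /patternP vv'.
have h x : exists y, forall w, (size w <= r)%N -> run v w = x -> run v' w = y.
  have [[w wr wx]|nx] := pselect (exists2 w, (size w <= r)%N & run v w = x).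
    exists (run v' w) => w' w'r w'x; apply/(vv' w' w) => //.
    by rewrite w'x wx.
  (* Arbitrary value at vertices that no short word reaches. *)
  by exists v' => w wr wx; case: nx; exists w.
have [F FP] := choice h.
by exists F => w wr; rewrite (FP (run v w) w).
Qed.

Lemma transports_dist_le r v v' F u :
  transports r v v' F -> dist_le v r u -> dist_le v' r (F u).
Proof.
move=> FP /dist_le_run [w wr <-]; apply/dist_le_run; exists w => //.
by rewrite FP.
Qed.

Lemma transportsK r v v' F F' u :
  transports r v v' F -> transports r v' v F' -> dist_le v r u -> F' (F u) = u.
Proof. by move=> FP FP' /dist_le_run [w wr <-]; rewrite FP ?FP'. Qed.

Lemma transportsS r v v' F : transports r.+1 v v' F -> transports r v v' F.
Proof. by move=> FP w wr; apply: FP; apply: leqW. Qed.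

Lemma transports_phi r v v' F u b :
  transports r.+1 v v' F -> dist_le v r u -> F (phi b u) = phi b (F u).
Proof.
move=> FP /dist_le_run [w wr <-]; have := FP (rcons w (b, true)).
by rewrite !run_rcons size_rcons /= (FP w (leqW wr)) => ->.
Qed.

(** An edge is moved by moving its origin and keeping its label; the extra letter in [r.+1] controls
    its other end. *)
Lemma transports_edge r v v' F e : transports r.+1 v v' F ->
  dist_le v r (ends e).1 /\ dist_le v r (ends e).2 ->
  dist_le v' r (ends (mk (F (ends e).1) (lab e))).1 /\
  dist_le v' r (ends (mk (F (ends e).1) (lab e))).2.
Proof.
move=> FP [e1 e2]; rewrite ends_mk /=.
split; first exact: transports_dist_le (transportsS FP) e1.
rewrite -(transports_phi _ FP) //.
by move: e2; rewrite endsE; apply: transports_dist_le (transportsS FP).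
Qed.

(* The ball of radius [r] needs words of length [r.+1]: they tell to which
   vertex of the ball the edge leaving a given vertex in a direction leads. *)
Lemma pattern_iso (r : nat) (v v' : vert G) :
  pattern r.+1 v = pattern r.+1 v' -> pg_iso (ball v r) (ball v' r).
Proof.
move=> vv'; have [F FP] := pattern_transports vv'.
have [F' FP'] := pattern_transports (esym vv').
have [FS FS'] := (transportsS FP, transportsS FP').
pose f (u : vert (pg_graph (ball v r))) : vert (pg_graph (ball v' r)) :=
  exist _ _ (transports_dist_le FS (svalP u)).
pose f' (u : vert (pg_graph (ball v' r))) : vert (pg_graph (ball v r)) :=
  exist _ _ (transports_dist_le FS' (svalP u)).
pose g (e : edge (pg_graph (ball v r))) : edge (pg_graph (ball v' r)) :=
  exist _ _ (transports_edge FP (svalP e)).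
pose g' (e : edge (pg_graph (ball v' r))) : edge (pg_graph (ball v r)) :=
  exist _ _ (transports_edge FP' (svalP e)).
exists f, g; split.
- exists f' => -[u uv]; apply: eq_exist => /=.
    exact: transportsK FS FS' uv.
  exact: transportsK FS' FS uv.
- exists g' => -[e [e1 e2]]; apply: eq_exist => /=; rewrite ends_mk lab_mk /=.
    by rewrite (transportsK FS FS') // mkK.
  by rewrite (transportsK FS' FS) // mkK.
- move=> [e [e1 e2]]; left; congr pair; apply: eq_exist => /=.
    by rewrite ends_mk.
  by rewrite ends_mk -(transports_phi _ FP) //= [in RHS]endsE.
- apply: eq_exist => /=.
  exact: (FP [::]).
Qed.

Lemma rtype_pattern r u v :
  pattern r.+1 u = pattern r.+1 v -> rtype u r = rtype v r.
Proof.
move=> uv; apply/seteqP; split=> P /=; apply: pg_iso_trans; exact: pattern_iso.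
Qed.

(* There are finitely many patterns, so the radii can be made uniform. *)
Lemma dense_holonomy_pattern :
  (forall r u, exists R, forall v,
     exists2 u', dist_le v R u' & pattern r u' = pattern r u) ->
  dense_holonomy G.
Proof.
move=> recur r.
have h c : exists R, forall u v, pattern r.+1 u = c ->
    exists2 u', dist_le v R u' & pattern r.+1 u' = c.
  have [[u uc]|nc] := pselect (exists u, pattern r.+1 u = c).
    have [R RP] := recur r.+1 u.
    by exists R => u1 v u1c; rewrite -uc; exact: RP.
  by exists 0%N => u v uc; case: nc; exists u.
have [R RP] := choice h.
exists (\max_c R c) => v _ [u _ <-].
have [u' [k kR ku'] u'P] := RP _ u v erefl.
exists u'; last exact: rtype_pattern.
by exists k => //; apply: leq_trans kR (leq_bigmax _).
Qed.

End SchreierGraph.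

Local Open Scope ring_scope.

Lemma finite_set_natP (A : set nat) :
  finite_set A <-> exists N, forall i, (N <= i)%N -> ~ A i.
Proof.
split=> [/finite_seqP[s ->]|[N NA]].
  exists (\max_(j <- s) j).+1 => i si /= si'.
  by have := @leq_bigmax_seq _ _ predT id _ si' isT; rewrite leqNgt si.
apply: sub_finite_set (finite_II N) => i Ai /=; rewrite ltnNge.
by apply/negP => /NA.
Qed.

(** * Truncations of a 2-adic integer and levels of vertices *)

Section Levels.
Variable omega : nat -> bool.
Local Notation X := (Xgraph omega).

(** The residue modulo [2 ^+ n] of the 2-adic integer [omega]. *)
Definition psum (n : nat) : int := \sum_(i < n) (omega i)%:R * 2 ^+ i.

Lemma psumS n : psum n.+1 = psum n + (omega n)%:R * 2 ^+ n.
Proof. by rewrite /psum big_ord_recr. Qed.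

Lemma acoefS n : acoef omega n.+1 = psum n.+1 - 2 ^+ n.
Proof. by []. Qed.

Lemma psum_ge0 n : 0 <= psum n.
Proof. by apply: sumr_ge0 => i _; rewrite mulr_ge0 ?ler0n ?exprn_ge0. Qed.

Lemma psum_lt n : psum n < 2 ^+ n.
Proof.
elim: n => [|n IH]; first by rewrite /psum big_ord0.
by rewrite psumS exprS; case: (omega n) => /=; lia.
Qed.

Lemma dvdz_psum n m : (n <= m)%N -> (2 ^+ n %| psum m - psum n)%Z.
Proof.
elim: m => [|m IH]; first by rewrite leqn0 => /eqP ->; rewrite subrr.
rewrite leq_eqVlt ltnS => /predU1P[->|nm]; first by rewrite subrr.
rewrite psumS addrAC; apply: rpredD; first exact: IH.
exact: dvdz_mull (dvdz_exp2l _ nm).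
Qed.

(** Both ends of an edge of family [n] satisfy the same congruence modulo [2 ^+ n]. The guard
    excludes family 0, which meets every vertex. *)
Definition at_level (n : nat) (v : int) : bool :=
  (0 < n)%N && (2 ^+ n %| v + acoef omega n)%Z.

Lemma at_levelD n v d :
  (2 ^+ n %| d)%Z -> at_level n (v + d) = at_level n v.
Proof. by move=> nd; rewrite /at_level addrAC rpredDr. Qed.

Lemma at_levelP n v :
  (0 < n)%N -> reflect (exists z, v = (level_ends omega n z).1) (at_level n v).
Proof.
case: n => [//|n] _; rewrite /at_level /=; apply: (iffP dvdzP) => -[z zE].
  by exists z => /=; rewrite mulrC -zE addrK.
by exists z; rewrite zE /= subrK mulrC.
Qed.

(** Write [v + psum n] as [z * 2 ^+ n] and let x be the digit [omega n]. The left side says that z +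
    x is even, [at_level n.+1 v] that z + x - 1 is. *)
Lemma dvdz_psum_step n v : (2 ^+ n %| v + psum n)%Z ->
  (2 ^+ n.+1 %| v + psum n.+1)%Z = ~~ at_level n.+1 v.
Proof.
move=> /dvdzP[z zE]; rewrite /at_level acoefS /= addrA psumS addrA zE -mulrDl.
rewrite -{3}[2 ^+ n]mul1r -mulrBl exprS !dvdz_mul2r ?expf_neq0 //.
by case: (omega n) => /=; lia.
Qed.

Lemma at_level_dvdz n v : at_level n.+1 v -> (2 ^+ n %| v + psum n)%Z.
Proof.
rewrite /at_level acoefS psumS /= => h.
have : (2 ^+ n %| v + (psum n + (omega n)%:R * 2 ^+ n - 2 ^+ n))%Z.
  by apply: dvdz_trans h; apply: dvdz_exp2l.
rewrite -addrA -{2}[2 ^+ n]mul1r -mulrBl addrA rpredDr //.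
exact: dvdz_mull.
Qed.

(** A larger level would force [2 ^+ n] to divide [v + psum n] for the smaller level [n], which the
    parity alternative rules out. *)
Lemma at_level_uniq n m v : at_level n v -> at_level m v -> n = m.
Proof.
wlog nm : n m / (n <= m)%N => [W nv mv|].
  by case: (leqP n m) => [|/ltnW] h; [apply: W|apply/esym/W].
case: n m nm => [|n] [|m] //; rewrite ltnS leq_eqVlt => /predU1P[->//|nm].
move=> nv /at_level_dvdz mv.
have : (2 ^+ n.+1 %| v + psum n.+1)%Z.
  have := dvdz_trans (dvdz_exp2l 2 nm) mv.
  by rewrite -[psum m](subrK (psum n.+1)) addrCA rpredDl // dvdz_psum.
by rewrite dvdz_psum_step ?at_level_dvdz // nv.
Qed.

Lemma level_ends_shift n z : (0 < n)%N ->
  (level_ends omega n z).2 = (level_ends omega n z).1 + 2 ^+ n.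
Proof. by case: n => // n _ /=; ring. Qed.

(** * Existence and uniqueness of the uncovered vertex *)

Lemma uncoveredP v : uncovered omega v <-> forall n, ~~ at_level n v.
Proof.
split=> [uv n|nv n z n0].
  apply/negP => nv; have n0 : (0 < n)%N by case/andP: nv.
  by move: nv => /(at_levelP _ n0)[z zE]; case: (uv n z n0).
have zl : at_level n (level_ends omega n z).1.
  by apply/(at_levelP _ n0); exists z.
split=> vE; have := nv n; rewrite vE ?zl //.
by rewrite level_ends_shift // at_levelD ?zl.
Qed.

(** This is the 2-adic equation v = - omega; each level that misses [v] raises the divisibility by
    one power of 2. *)
Lemma uncovered_dvdz v :
  uncovered omega v <-> forall n, (2 ^+ n %| v + psum n)%Z.
Proof.
rewrite uncoveredP; split=> [nv n|dv [//|n]]; last by rewrite -dvdz_psum_step.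
elim: n => [|n IH]; first by rewrite expr0 dvd1z.
by rewrite dvdz_psum_step.
Qed.

Lemma dvdz_lt_eq0 (m d : int) : (m %| d)%Z -> `|d| < m -> d = 0.
Proof.
rewrite dvdzE => md dm; apply/eqP; rewrite -absz_eq0 -leqn0 leqNgt.
by apply/negP => /dvdn_leq /(_ md); lia.
Qed.

Lemma ltr_absz_exp2 (v : int) n : (`|v| <= n)%N -> `|v| < 2 ^+ n.
Proof.
move=> vn; have := leq_ltn_trans vn (ltn_expl n (isT : 1 < 2)%N).
have -> : 2 ^+ n = (2 ^ n)%N%:Z :> int by rewrite -natz natrX.
by lia.
Qed.

Lemma uncovered_inj v v' : uncovered omega v -> uncovered omega v' -> v = v'.
Proof.
move=> /uncovered_dvdz dv /uncovered_dvdz dv'; apply/eqP; rewrite -subr_eq0.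
(* The difference is divisible by every power of 2, in particular by one exceeding its absolute
   value. *)
apply/eqP; apply: (@dvdz_lt_eq0 (2 ^+ `|v - v'|%N)); last exact: ltr_absz_exp2.
set n := `|_|%N; rewrite -(addrKA (psum n)) [_ + v']addrC.
exact: rpredB.
Qed.

(** A 2-adic integer is an ordinary integer iff its digits are eventually constant: 0 if it is
    nonnegative, 1 if it is negative. *)
Lemma exists_uncovered :
  (exists v, uncovered omega v) <->
  finite_set [set i | omega i = false] \/ finite_set [set i | omega i = true].
Proof.
rewrite !finite_set_natP; split=> [[v /uncovered_dvdz dv]|].
  have [v0|v0] := leP v 0.
    right; exists `|v|%N => i vi /= iT.
    (* Here [v + psum n] lies strictly between [- 2 ^+ n] and [2 ^+ n], so it vanishes. *)
    have psumE n : (`|v| <= n)%N -> psum n = - v.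
      move=> /ltr_absz_exp2 vn; have := psum_ge0 n; have := psum_lt n => p1 p0.
      by have := dvdz_lt_eq0 (dv n); lia.
    have := psumE _ vi; have := psumE _ (leqW vi); rewrite psumS iT.
    by have := exprn_gt0 i (isT : 0 < 2 :> int); lia.
  left; exists `|v|%N => i vi /= iF.
  (* Here [v + psum n] lies strictly between 0 and [2 ^+ n.+1], so it equals [2 ^+ n]. *)
  have psumE n : (`|v| <= n)%N -> psum n = 2 ^+ n - v.
    move=> /ltr_absz_exp2 vn; have := psum_ge0 n; have := psum_lt n => p1 p0.
    have := dvdz_lt_eq0 (rpredB (dv n) (dvdzz (2 ^+ n))); lia.
  have := psumE _ vi; have := psumE _ (leqW vi); rewrite psumS iF exprS.
  by have := exprn_gt0 i (isT : 0 < 2 :> int); lia.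
have ext N v :
    (forall n, (N <= n)%N -> (2 ^+ n %| v + psum n)%Z) -> uncovered omega v.
  move=> dv; apply/uncovered_dvdz => n.
  have [/dv //|/ltnW nN] := leqP N n.
  have := dvdz_trans (dvdz_exp2l 2 nN) (dv N (leqnn N)).
  by rewrite -[psum N](subrK (psum n)) addrCA rpredDl // dvdz_psum.
move=> [] [N NP].
  (* The digits are 1 from [N] on, and 2-adically the powers [2 ^+ i] with i >= N sum to
     [- 2 ^+ N]. *)
  exists (2 ^+ N - psum N); apply: (ext N) => n Nn.
  suff -> : psum n = psum N + 2 ^+ n - 2 ^+ N.
    by have -> : 2 ^+ N - psum N + (psum N + 2 ^+ n - 2 ^+ N) = 2 ^+ n by ring.
  elim: n Nn => [|n IH]; first by rewrite leqn0 => /eqP ->; rewrite addrK.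
  rewrite leq_eqVlt ltnS => /predU1P[->|Nn]; first by rewrite addrK.
  rewrite psumS IH // exprS; move: (NP n Nn) => /=; case: (omega n) => // _.
  by rewrite /=; lia.
exists (- psum N); apply: (ext N) => n Nn.
suff -> : psum n = psum N by rewrite addNr dvdz0.
elim: n Nn => [|n IH]; first by rewrite leqn0 => /eqP ->.
rewrite leq_eqVlt ltnS => /predU1P[->//|Nn].
rewrite psumS IH //; move: (NP n Nn) => /=; case: (omega n) => // _.
by rewrite mul0r addr0.
Qed.

(** * The level function and local finiteness *)

(** The value 0 is taken exactly at an uncovered vertex. *)
Definition lvl (v : int) : nat := xget 0%N [set n | at_level n v].

Lemma lvlE n v : at_level n v -> lvl v = n.
Proof.
move=> nv; apply: (at_level_uniq _ nv).
by apply: (@xgetPex _ 0%N [set n | at_level n v]); exists n.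
Qed.

Lemma at_level_lvl v : ~ uncovered omega v -> at_level (lvl v) v.
Proof.
rewrite uncoveredP => /existsNP[n /negP]; rewrite negbK => nv.
by rewrite (lvlE nv).
Qed.

Lemma lvlD v d :
  ~ uncovered omega v -> (2 ^+ lvl v %| d)%Z -> lvl (v + d) = lvl v.
Proof. by move=> /at_level_lvl lv dd; apply: lvlE; rewrite at_levelD. Qed.

Definition neighbors (v : int) : seq int :=
  [:: v; v + 1; v - 1; v + 2 ^+ lvl v; v - 2 ^+ lvl v].

Lemma joins_neighbors (e : edge X) (u v : int) :
  joins e u v -> u \in neighbors v.
Proof.
have cases (x y : int) :
    y = x + 1 \/ (exists2 n, at_level n x & y = x + 2 ^+ n) \/ y = x ->
    (u = x /\ v = y) \/ (u = y /\ v = x) ->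
    u \in neighbors v.
  move=> [->|[[n nx ->]|->]] [[-> ->]|[-> ->]];
    rewrite !inE ?addrK ?eqxx ?orbT //.
    by rewrite (lvlE (n := n)) ?at_levelD // addrK eqxx !orbT.
  by rewrite (lvlE nx) eqxx !orbT.
move=> uv; apply: (cases (ends e).1 (ends e).2).
  case: e uv => [[[|n] z]|[x xu]] _ /=; [by left| |by right; right].
  right; left; exists n.+1; last exact: (@level_ends_shift n.+1).
  by apply/(@at_levelP n.+1) => //; exists z.
by case: uv => ->; [left|right].
Qed.

Lemma finite_walk (k : nat) (v : int) :
  finite_set [set u : int | @walk X k u v].
Proof.
elim: k v => [|k IH] v.
  apply: sub_finite_set (finite_set1 v) => u /= w.
  by inversion w.
have := bigcup_finite (IH v) (fun x _ => finite_seq (neighbors x)).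
apply: sub_finite_set => u /= w; inversion w as [|k' e u' x v' ux xv]; subst.
by exists x => //; exact: joins_neighbors ux.
Qed.

(** The target is fixed and the centre varies: this bounds the number of [R]-balls that contain
    [v]. *)
Lemma finite_ball_to (R : nat) (v : int) :
  finite_set [set u : int | @dist_le X u R v].
Proof.
have := bigcup_finite (finite_II R.+1) (fun k _ => finite_walk k v).
by apply: sub_finite_set => u [k kR w]; exists k.
Qed.

(** * A loop obstructs dense holonomy *)

Lemma infinite_int : infinite_set [set: int].
Proof.
move=> fin; apply: infinite_nat.
have inj : {in Posz @^-1` [set: int] &, injective Posz} by move=> x y _ _ [].
exact: finite_preimage inj fin.
Qed.

(* Only the uncovered vertex carries a loop, which is seen in the ball of
   radius 0. *)
Lemma uncovered_rtype0 (u v : int) : uncovered omega v ->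
  @rtype X u 0 = @rtype X v 0 -> u = v.
Proof.
move=> vu uv.
have : @rtype X u 0 (@ball X u 0) by exact: pg_iso_refl.
rewrite uv => -[f [g [_ _ _ _]]].
have c := @dist_le_center X v 0.
pose l : edge (pg_graph (@ball X v 0)) :=
  exist _ (inr (exist _ v vu) : edge X) (conj c c).
have dist0 x : @dist_le X u 0 x -> x = u.
  by move=> [k]; rewrite leqn0 => /eqP -> w; inversion w.
(* The image of the loop has both ends at [u], whereas an edge of a family has distinct ends; so it
   is the loop of an uncovered vertex. *)
case: (g l) => -[[n z]|[x xu]] /= [/dist0 e1 /dist0 e2].
  have : (level_ends omega n z).1 != (level_ends omega n z).2.
    case: n {e1 e2} => [|n]; first by rewrite /=; lia.
    rewrite level_ends_shift //.
    by have := exprn_gt0 n.+1 (isT : 0 < 2 :> int); lia.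
  by rewrite e1 e2 eqxx.
by rewrite -e1; exact: uncovered_inj xu vu.
Qed.

(** The 0-type of an uncovered vertex occurs nowhere else, so balls of one radius around all
    integers would have to contain that vertex. *)
Lemma dense_holonomy_covered :
  dense_holonomy X -> ~ exists v, uncovered omega v.
Proof.
move=> dense [v vu]; have [R RP] := dense 0%N.
apply: infinite_int; apply: sub_finite_set (finite_ball_to R v) => u _ /=.
have [|x ux xv] := RP u (@rtype X v 0); first by exists v.
by rewrite -(uncovered_rtype0 vu xv).
Qed.

(** * Recurrence of patterns when every vertex has a level *)

Lemma walk_down (k : nat) (u : int) : @walk X k u (u - k%:Z).
Proof.
elim: k u => [|k IH] u; first by rewrite subr0; exact: walk_nil.
apply: (@walk_cons X k (inl (0%N, u - 1)) u (u - 1)).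
  by right; rewrite /= subrK.
have -> : u - k.+1%:Z = u - 1 - k%:Z by lia.
exact: IH.
Qed.

Definition up (b : bool) (u : int) : int := u + (if b then 2 ^+ lvl u else 1).
Definition down (b : bool) (u : int) : int := u - (if b then 2 ^+ lvl u else 1).

(** The quotient is the index of the edge of family [lvl u] whose first end is [u]. *)
Definition edge_at (u : int) (b : bool) : edge X :=
  inl (if b then (lvl u, (u + acoef omega (lvl u)) %/ 2 ^+ lvl u)%Z
       else (0%N, u)).

Definition edge_dir (e : edge X) : bool :=
  if e is inl p then (0 < p.1)%N else true.

Hypothesis covered : forall v, ~ uncovered omega v.

Lemma lvl_gt0 u : (0 < lvl u)%N.
Proof. by case/andP: (at_level_lvl (@covered u)). Qed.

(** A step of size [2 ^+ lvl u] preserves the level, so a step of the same size undoes it. *)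
Lemma upK b : cancel (up b) (down b).
Proof. by case: b => u; rewrite /up /down ?addrK // lvlD // addrK. Qed.

Lemma downK b : cancel (down b) (up b).
Proof.
by case: b => u; rewrite /up /down ?subrK // lvlD ?rpredN // subrK.
Qed.

Lemma ends_edge_at u b : ends (edge_at u b) = (u, up b u).
Proof.
rewrite /up; case: b => //=; have /andP[l0 ld] := at_level_lvl (@covered u).
have e1 : (level_ends omega (lvl u)
    ((u + acoef omega (lvl u)) %/ 2 ^+ lvl u)%Z).1 = u.
  by case: (lvl u) l0 ld => //= n _ ld; rewrite mulrC divzK // addrK.
by rewrite [LHS]surjective_pairing level_ends_shift // e1.
Qed.

Lemma edge_atK (e : edge X) : edge_at (ends e).1 (edge_dir e) = e.
Proof.
case: e => [[[|n] z]|[x /covered //]] //=; rewrite /edge_at.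
have -> : lvl (2 ^+ n.+1 * z - acoef omega n.+1) = n.+1.
  by apply: lvlE; apply/at_levelP => //; exists z.
by rewrite subrK mulKz // expf_neq0.
Qed.

Lemma edge_dir_at u b : edge_dir (edge_at u b) = b.
Proof. by case: b => //=; exact: lvl_gt0. Qed.

Local Notation Xrun := (@run X bool up down).

(** The two runs stay parallel: the translation preserves every level met, hence the size of every
    step. *)
Lemma run_shift (N r : nat) (u k : int) :
  (forall w, (size w <= r)%N -> (lvl (Xrun u w) <= N)%N) ->
  forall w, (size w <= r)%N ->
    Xrun (u + 2 ^+ N * k) w =
    Xrun u w + 2 ^+ N * k.
Proof.
move=> lN w; elim/last_ind: w => [//|w [b s] IH]; rewrite size_rcons => wr.
rewrite !run_rcons IH; last exact: ltnW.
have ld := lvlD (@covered _) (dvdz_mulr k (dvdz_exp2l 2 (lN w (ltnW wr)))).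
by case: s; case: b => /=; rewrite /up /down ?ld addrAC.
Qed.

Lemma covered_dense_holonomy : dense_holonomy X.
Proof.
have recur := @dense_holonomy_pattern X bool up down edge_at edge_dir
  upK downK ends_edge_at edge_atK edge_dir_at.
apply: recur => r u.
have [N lN] : exists N, forall w, (size w <= r)%N -> (lvl (Xrun u w) <= N)%N.
  exists (\max_(w : r.-bseq (bool * bool)) lvl (Xrun u w)) => w wr.
  exact: (@leq_bigmax _ (fun w : r.-bseq _ => lvl (Xrun u w)) (Bseq wr)).
(* Among the [2 ^ N] consecutive integers ending at [v] one is congruent to [u] modulo [2 ^+ N];
   edges of family 0 lead down to it. *)
exists (2 ^ N)%N => v.
have pN : 2 ^+ N = (2 ^ N)%N%:Z :> int by rewrite -natz natrX.
have p0 : (2 ^+ N : int) != 0 by rewrite expf_neq0.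
have := divz_eq (v - u) (2 ^+ N); have := modz_ge0 (v - u) p0.
have := ltz_mod (v - u) p0.
set q := (_ %/ _)%Z; set m := (_ %% _)%Z => mlt m0 vE.
exists (u + 2 ^+ N * q).
  exists `|m|%N; first by move: mlt; rewrite pN; lia.
  have -> : u + 2 ^+ N * q = v - `|m|%N%:Z; last exact: walk_down.
  by rewrite gez0_abs // -[v in RHS](subrK u) vE; ring.
apply/patternP => w1 w2 s1 s2; rewrite !(run_shift _ lN) //.
by split=> [/addIr|->].
Qed.

End Levels.

Theorem theorem7 (omega : nat -> bool) :
  dense_holonomy (Xgraph omega) <->
  infinite_set [set i : nat | omega i = false] /\
  infinite_set [set i : nat | omega i = true].
Proof.
rewrite -not_orP -exists_uncovered; split; first exact: dense_holonomy_covered.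
by move=> cov; apply: covered_dense_holonomy => v vu; apply: cov; exists v.
Qed.
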